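(* Let $\mathcal Q=\{Q^{(a)}\}_{a\in[k]}$ be arbitrary probability distributions on $\mathcal Y$ with gaps $\{\Delta(a)\}_{a\in[k]}$, and let $\eta>0$ be such that $p(x,Q^{(a)})>\eta$ for all $x\in\mathcal X$ and $a\in[k]$. Assume that the LCB lossy compression algorithm (defined in the context, with the constant $c$ specified there) is run with $\mathcal Q$ and $\delta_t=t^{-\alpha}$ for some $\alpha>2$. Then for every $t\ge1$ the pseudo-regret satisfies $$\mathsf{preg}_t\le\sum_{a\in[k]:\,\Delta(a)>0}\left[\frac{4c^2\alpha}{\eta^2\Delta(a)}\log(t)+\frac{2(\alpha-1)}{\alpha-2}\,\Delta(a)\right].$$
   Context: $\mathcal X,\mathcal Y$ are general measurable alphabets, $\rho:\mathcal X\times\mathcal Y\to\mathbb R$ is a measurable distortion measure, $d$ a distortion level, $P_X$ a distribution on $\mathcal X$, $[k]=\{1,\dots,k\}$, and $\log$ is the natural logarithm. A codebook is an infinite sequence $\mathcal C=(y(1),y(2),\dots)$ in $\mathcal Y$; $\mathcal C\sim Q$ means its codewords are IID from $Q$. Let $J(x,\mathcal C)=\inf\{j\ge1:\rho(x,y(j))\le d\}$, $p(x,Q)=\mathbb P_{Y\sim Q}[\rho(x,Y)\le d]$, and $\tilde b(Q)=\mathbb E_{X\sim P_X,\mathcal C\sim Q}[\log J(X,\mathcal C)]$ with $X,\mathcal C$ independent. Optimal action and gaps: $a^*\in\arg\min_{a\in[k]}\tilde b(Q^{(a)})$ and $\Delta(a)=\tilde b(Q^{(a)})-\tilde b(Q^{(a^*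 )})$. Constant $c$: $c>0$ is an absolute constant such that, for every $\eta>0$, every $Q$ with $p(x,Q)>\eta$ for all $x$, every $n\ge1$ and every $\delta\in(0,1/2)$, if $X_1,\dots,X_n$ are IID $P_X$ and $\mathcal C_1,\dots,\mathcal C_n\sim Q$ are independent codebooks, independent of the $X_i$, then with probability at least $1-\delta$, $\left|\frac1n\sum_{i=1}^n\log J(X_i,\mathcal C_i)-\tilde b(Q)\right|\le\frac c\eta\sqrt{\frac1n\log\frac1\delta}$. LCB algorithm: for $(B_1,\dots,B_n)$ put $\mathrm{LCB}((B_1,\dots,B_n),\delta,n)=\frac1n\sum_{i=1}^nB_i-\frac c\eta\sqrt{\frac1n\log\frac1\delta}$ for $n\ge1$, and $\mathrm{LCB}=-\infty$ for $n=0$. At round $t=1,2,\dots$, choose $A_t\in\arg\min_{a\in[k]}\mathrm{LCB}(\mathcal B_t(a),\delta_t,n_t(a))$ (ties broken arbitrarily), where $\mathcal B_t(a)$ is the list of the costs incurred in rounds before $t$ in which action $a$ was played and $n_t(a)$ is its length; then draw a fresh codebook $\mathcal C_t\sim Q^{(A_t)}$ and an independent fresh source sample $X_t\sim P_X$ (IID over time), and incur the cost $B_t=\log J(X_t,\mathcal C_t)$. Pseudo-regret: $\mathsf{preg}_t=\mathbb E\left[\sum_{i=1}^t\big(\tilde b(Q^{(A_i)})-\tilde b(Q^{(a^* )})\big)\right]=\mathbb E\left[\sum_{a:\Delta(a)>0}N_t(a)\Delta(a)\right]$, where $N_t(a)$ is the number of rounds among $1,\dots,t$ in which $a$ was played.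 *)

(* Defs.v *)
From HB Require Import structures.
From mathcomp Require Export all_boot all_order all_algebra.
From mathcomp Require Export all_classical all_reals all_analysis.
Export Order.TTheory GRing.Theory Num.Theory.
Export numFieldNormedType.Exports.

Set Implicit Arguments.
Unset Strict Implicit.
Unset Printing Implicit Defensive.

Local Open Scope classical_set_scope.
Local Open Scope ring_scope.

(* A codebook (y(1), y(2), ...) is stored with indices shifted by one: the
   codeword y(j.+1) is [y j].  The set of codebooks carries the product
   sigma-algebra. *)
Definition coordinate_events d (Y : measurableType d) : set (set (nat -> Y)) :=
  [set E | exists j (F : set Y), measurable F /\ E = [set y | F (y j)]].

Definition codebook d (Y : measurableType d) :=
  g_sigma_algebraType (@coordinate_events d Y).

HB.instance Definition _ d (Y : measurableType d) :=
  Measurable.on (codebook Y).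

(* [PC] is the law of C ~ Q.  The cylinder probabilities determine it, and it
   exists for every Q by the theorem on infinite products of probability
   spaces, which needs no assumption on the alphabet. *)
Definition is_codebook_law (R : realType) d (Y : measurableType d)
    (Q : probability Y R) (PC : probability (codebook Y) R) : Prop :=
  forall (m : nat) (F : nat -> set Y), (forall j, measurable (F j)) ->
    PC [set y | forall j, (j < m)%N -> F j (y j)]
    = (\prod_(j < m) Q (F j))%E.

Section cost.
Context (R : realType) dX dY (X : measurableType dX) (Y : measurableType dY).
Variables (rho : X * Y -> R) (d : R).

(* +oo when no codeword matches x. *)
Definition first_match (x : X) (y : codebook Y) : \bar R :=
  ereal_inf [set j.+1%:R%:E | j in [set j : nat | rho (x, y j) <= d]].

Definition cost (x : X) (y : codebook Y) : \bar R := lne (first_match x y).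

Definition match_prob (Q : probability Y R) (x : X) : \bar R :=
  Q [set y | rho (x, y) <= d].

(* The expectation of [cost] lies in [0, +oo] in general; it is finite, and
   [fine] loses nothing, as soon as [match_prob] is bounded away from 0. *)
Definition mean_cost (PX : probability X R) (PC : probability (codebook Y) R)
    : R :=
  fine (\int[(PX \x PC)%E]_z cost z.1 z.2)%E.

End cost.

Definition radius (R : realType) (c eta delta : R) (n : nat) : R :=
  c / eta * Num.sqrt (n%:R^-1 * ln delta^-1).

(* All 2n variables are mutually independent; taking some of the events to be
   setT gives the product rule for every subfamily. *)
Definition iid_samples (R : realType) dO dX dY (Omega : measurableType dO)
    (X : measurableType dX) (Y : measurableType dY)
    (P : probability Omega R) (PX : probability X R)
    (PC : probability (codebook Y) R) (n : nat)
    (Xs : 'I_n -> {RV P >-> X}) (Cs : 'I_n -> {RV P >-> codebook Y}) : Prop :=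
  forall (E : 'I_n -> set X) (F : 'I_n -> set (codebook Y)),
    (forall i, measurable (E i)) -> (forall i, measurable (F i)) ->
    P [set w | forall i, E i (Xs i w) /\ F i (Cs i w)]
    = ((\prod_(i < n) PX (E i)) * (\prod_(i < n) PC (F i)))%E.

(* [c] is absolute: the alphabets, the source, the distortion measure and the
   distortion level are quantified inside. *)
Definition concentration_constant (R : realType) (c : R) : Prop :=
  0 < c /\
  forall dX dY (X : measurableType dX) (Y : measurableType dY)
    (rho : X * Y -> R) (d : R) (PX : probability X R) (eta : R)
    (Q : probability Y R) (PC : probability (codebook Y) R),
    measurable_fun [set: X * Y] rho ->
    0 < eta ->
    (forall x, (eta%:E < match_prob rho d Q x)%E) ->
    is_codebook_law Q PC ->
  forall (n : nat) (delta : R), (1 <= n)%N -> 0 < delta -> delta < 2^-1 ->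
  forall dO (Omega : measurableType dO) (P : probability Omega R)
    (Xs : 'I_n -> {RV P >-> X}) (Cs : 'I_n -> {RV P >-> codebook Y}),
    iid_samples PX PC Xs Cs ->
    ((1 - delta)%:E <=
     P [set w | `| n%:R^-1%:E * (\sum_(i < n) cost rho d (Xs i w) (Cs i w))
                   - (mean_cost rho d PX PC)%:E |
                <= (radius c eta delta n)%:E])%E.

Definition lcb (R : realType) (c eta : R) (B : seq (\bar R)) (delta : R)
    : \bar R :=
  if size B is 0%N then -oo%E
  else ((size B)%:R^-1%:E * (\sum_(b <- B) b)
        - (radius c eta delta (size B))%:E)%E.

Section algorithm.
Context (R : realType) dO dX dY (Omega : measurableType dO)
  (X : measurableType dX) (Y : measurableType dY) (k : nat).
Variables (P : probability Omega R) (rho : X * Y -> R) (d : R).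

(* Rounds are 1, 2, ...; round 0 is never looked at. *)
Variables (A : nat -> Omega -> 'I_k) (Xs : nat -> {RV P >-> X})
  (Cs : nat -> {RV P >-> codebook Y}).

Definition past_costs (t : nat) (a : 'I_k) (w : Omega) : seq (\bar R) :=
  [seq cost rho d (Xs i w) (Cs i w) | i <- iota 1 t.-1 & A i w == a].

(* Everything known when the draws of round t are made: the actions of rounds
   1, ..., t and the samples and codebooks of rounds 1, ..., t - 1. *)
Definition history (t : nat) : set (set Omega) :=
  <<s [set H | (exists i a, (1 <= i <= t)%N /\ H = A i @^-1` [set a])
            \/ (exists i (E : set X), [/\ (1 <= i < t)%N, measurable E &
                  H = Xs i @^-1` E])
            \/ (exists i (F : set (codebook Y)),
                  [/\ (1 <= i < t)%N, measurable F & H = Cs i @^-1` F])] >>.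

(* [lcb_fresh] says that, conditionally on the history and on A_t = a, the
   pair (X_t, C_t) has law PX x PC(a).  Ties are broken in any measurable way,
   possibly randomized and depending on the past. *)
Record lcb_run (PX : probability X R)
    (PC : 'I_k -> probability (codebook Y) R) (c eta : R) (delta : nat -> R)
    : Prop := LcbRun {
  lcb_measurable : forall t a, (1 <= t)%N -> measurable (A t @^-1` [set a]);
  lcb_choice : forall t w a, (1 <= t)%N ->
    (lcb c eta (past_costs t (A t w) w) (delta t)
     <= lcb c eta (past_costs t a w) (delta t))%E;
  lcb_fresh : forall t a (H : set Omega) (E : set X) (F : set (codebook Y)),
    (1 <= t)%N -> history t H -> measurable E -> measurable F ->
    P (H `&` A t @^-1` [set a] `&` (Xs t @^-1` E `&` Cs t @^-1` F))
    = (P (H `&` A t @^-1` [set a]) * (PX E * PC a F))%E }.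

End algorithm.

Definition gap (R : realType) (k : nat) (b : 'I_k -> R) (astar a : 'I_k) : R :=
  b a - b astar.

Definition pseudo_regret (R : realType) dO (Omega : measurableType dO)
    (P : probability Omega R) (k : nat) (b : 'I_k -> R) (astar : 'I_k)
    (A : nat -> Omega -> 'I_k) (t : nat) : \bar R :=
  ('E_P[(fun w => \sum_(1 <= i < t.+1) gap b astar (A i w))%R])%E.

(* Main.v *)
(** If arm [a] is played although it has been played more than [u] times, where
    [u] makes twice the confidence radius smaller than the gap of [a], then the
    empirical mean of [a] or that of the optimal arm lies outside its confidence
    interval.  A union bound over the possible numbers of plays bounds the
    probability of this in round [s] by [2 (s - 1) s^(-alpha)], which sums to at
    most [2 / (alpha - 2)].

    The concentration hypothesis speaks about a fixed number [n] of IID draws,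
    whereas an arm may be played fewer than [n] times, at random instants.  On
    the product of the sample space with a space carrying [n] further IID draws,
    the list of draws of the arm is completed to exactly [n] draws, and these
    are IID; when the arm has been played exactly [n] times, the completion
    leaves the list unchanged. *)

Require Import Defs.
From mathcomp Require Import measurable_realfun ring lra.

Set Implicit Arguments.
Unset Strict Implicit.
Unset Printing Implicit Defensive.

Local Open Scope classical_set_scope.
Local Open Scope ring_scope.

(** * Measurability of the cost *)

Lemma measurable_lne (R : realType) : measurable_fun [set: \bar R] (@lne R).
Proof.
rewrite (_ : @lne R = fun x => if x == +oo%E then +oo%E else
    if (x <= 0)%E then -oo%E else (ln (fine x))%:E); last first.
  by apply/funext => -[r| |] /=; rewrite ?eqxx ?lee_fin // leNye.
apply: measurable_fun_ifT; [| |apply: measurable_fun_ifT].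
- apply: (measurable_fun_bool true); rewrite setTI.
  rewrite (_ : _ @^-1` _ = [set +oo%E]); first exact: emeasurable_set1.
  by apply/seteqP; split => x /= /eqP.
- exact: measurable_cst.
- apply: (measurable_fun_bool true).
  have := emeasurable_fun_infty_c (@measurableT _ (\bar R))
    (@measurable_id _ (\bar R) setT) 0%E.
  by congr measurable; apply/seteqP; split => x /=.
- exact: measurable_cst.
- apply/measurable_EFinP; apply: measurableT_comp; first exact: measurable_ln.
  exact: fine_measurable.
Qed.

Lemma measurable_codeword d (Y : measurableType d) (j : nat) :
  measurable_fun [set: codebook Y] (fun y : codebook Y => y j).
Proof.
move=> _ F mF; rewrite setTI; apply: sub_sigma_algebra.
by exists j, F.
Qed.

Section cost.
Context (R : realType) dX dY (X : measurableType dX) (Y : measurableType dY).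
Variables (rho : X * Y -> R) (d : R).

(** The infimum over a set of indices depending on [x] and [y] becomes an infimum of a fixed
    sequence of functions, whose measurability follows termwise; a codeword that does not match
    contributes [+oo]. *)
Lemma first_matchE (x : X) (y : codebook Y) :
  first_match rho d x y =
  einfs (fun j => if rho (x, y j) <= d then j.+1%:R%:E else +oo%E) 0.
Proof.
apply/eqP; rewrite eq_le; apply/andP.
split; apply: le_ereal_inf_tmp => _ [j /= jd <-].
- case: ifPn => [rd|_]; last exact: leey.
  by apply: ereal_inf_lbound; exists j.
- by apply: ereal_inf_lbound; exists j => //=; rewrite jd.
Qed.

Lemma measurable_cost : measurable_fun [set: X * Y] rho ->
  measurable_fun [set: X * codebook Y]
    (fun z : X * codebook Y => cost rho d z.1 z.2).
Proof.
move=> mrho; apply: measurableT_comp; first exact: measurable_lne.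
rewrite [X in measurable_fun _ X](_ : _ = fun z : X * codebook Y =>
    einfs (fun j => if rho (z.1, z.2 j) <= d then j.+1%:R%:E else +oo%E) 0);
  last first.
  by apply/funext => z; exact: first_matchE.
apply: measurable_fun_einfs => j.
apply: measurable_fun_ifT; [|exact: measurable_cst|exact: measurable_cst].
apply: measurable_fun_ler; last exact: measurable_cst.
apply: (measurableT_comp mrho); apply: measurable_fun_pair => //.
exact: measurableT_comp (measurable_codeword _) _.
Qed.

End cost.

(** * Splitting along a discrete variable, and auxiliary IID sequences *)

Lemma measure_fibers d (T : measurableType d) (R : realType)
    (mu : {measure set T -> \bar R}) n (f : T -> nat) (A : set T) :
  measurable A -> (forall x, (f x < n)%N) ->
  (forall j, measurable (f @^-1` [set j])) ->
  mu A = (\sum_(j < n) mu (A `&` f @^-1` [set (j : nat)]))%E.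
Proof.
move=> mA fn mf.
rewrite -(@measure_bigsetU_ord _ _ _ mu _ xpredT
  (fun j => A `&` f @^-1` [set (j : nat)])).
- congr (mu _); rewrite -(bigcup_mkord _ (fun j => A `&` f @^-1` [set j])).
  by apply/seteqP; split => [x Ax|x [j _ []//]]; exists (f x) => //; exact: fn.
- by move=> j; exact: measurableI.
- move=> i j _ _ [x [[_ /= fi] [_ /= fj]]].
  by apply/val_inj; exact: etrans (esym fi) fj.
Qed.

(** Finitely many draws suffice, so binary products adjoined one at a time give the space. The
    sequence is indexed by [nat], but only its terms below [n] are controlled. *)
Lemma iid_sequence_exists (R : realType) d (T : measurableType d)
    (mu : probability T R) (n : nat) :
  exists dW (W : measurableType dW) (PW : probability W R) (U : nat -> W -> T),
    (forall i, measurable_fun [set: W] (U i)) /\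
    forall G : nat -> set T, (forall i, measurable (G i)) ->
      PW [set u | forall i, (i < n)%N -> G i (U i u)]
      = (\prod_(i < n) mu (G i))%E.
Proof.
elim: n => [|n [dW [W [PW [U [mU UE]]]]]].
  (* With no draw to control, any probability space serves; [T] itself is at hand. *)
  exists d, T, mu, (fun=> id); split => // G mG.
  rewrite big_ord0 (_ : [set _ | _] = setT) ?probability_setT //.
  by apply/seteqP; split.
exists _, (W * T)%type, (PW \x mu)%E,
  (fun i u => if i == n then u.2 else U i u.1); split => [i|G mG].
  by case: eqP => _; [exact: measurable_snd|exact: measurableT_comp].
rewrite big_ord_recr /= -UE // -product_measure1E //; last first.
  rewrite (_ : [set _ | _] =
    \bigcap_(i in [set i | (i < n)%N]) (U i @^-1` G i)) //.
  apply: bigcap_measurableType => // i _; rewrite -[X in measurable X]setTI.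
  exact: mU.
congr (_ _); apply/seteqP; split => -[w x] /=.
- move=> H; split => [i ltin|]; last by have := H n; rewrite eqxx; exact.
  by have := H i (ltnW ltin); rewrite (ltn_eqF ltin).
- move=> [HU HG] i; rewrite ltnS leq_eqVlt; case: eqP => [-> //|_ /= ltin].
  exact: HU.
Qed.

Lemma product_probabilityE (R : realType) d1 d2 (T1 : measurableType d1)
    (T2 : measurableType d2) (P1 : probability T1 R) (P2 : probability T2 R)
    (A1 : set T1) (A2 : set T2) : measurable A1 -> measurable A2 ->
  (P1 \x P2)%E (A1 `*` A2) = (P1 A1 * P2 A2)%E.
Proof. exact: product_measure1E. Qed.

(** * The draws of one arm and their completion to an IID sample *)

Section adaptive_sampling.
Context (R : realType) dO dX dY (Omega : measurableType dO)
  (X : measurableType dX) (Y : measurableType dY) (k : nat)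
  (P : probability Omega R) (A : nat -> Omega -> 'I_k)
  (Xs : nat -> {RV P >-> X}) (Cs : nat -> {RV P >-> codebook Y}) (a : 'I_k).

Definition draws (r : nat) (w : Omega) : seq (X * codebook Y) :=
  [seq (Xs i w, Cs i w) | i <- iota 1 r & A i w == a].

Lemma drawsS r w : draws r.+1 w =
  if A r.+1 w == a then rcons (draws r w) (Xs r.+1 w, Cs r.+1 w)
  else draws r w.
Proof.
rewrite /draws -{1}[r.+1]addn1 iotaD filter_cat map_cat /= add1n.
by case: ifP => _; rewrite ?cats1 ?cats0.
Qed.

Lemma size_draws_le r w : (size (draws r w) <= r)%N.
Proof. by rewrite size_map size_filter -{2}(size_iota 1 r) count_size. Qed.

Lemma history_le s t : (s <= t)%N -> history A Xs Cs s `<=` history A Xs Cs t.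
Proof.
move=> st; apply: sub_sigma_algebra2 => H [[i [b [/andP[i1 it] HE]]]|[|]].
- by left; exists i, b; rewrite i1 (leq_trans it st).
- move=> [i [E [/andP[i1 it] mE HE]]]; right; left; exists i, E; split=> //.
  by rewrite i1 (leq_trans it st).
- move=> [i [F [/andP[i1 it] mF HF]]]; right; right; exists i, F; split=> //.
  by rewrite i1 (leq_trans it st).
Qed.

Hypothesis measurable_action : forall t b, (1 <= t)%N ->
  measurable (A t @^-1` [set b]).

Lemma history_measurable t : history A Xs Cs t `<=` measurable.
Proof.
apply: smallest_sub; first exact: sigma_algebra_measurable.
move=> H [[i [b [/andP[i1 _] ->]]]|[|]]; first exact: measurable_action.
- by move=> [i [E [_ mE ->]]]; exact: measurable_funPTI.
- by move=> [i [F [_ mF ->]]]; exact: measurable_funPTI.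
Qed.

(** Freshness of round [r.+1] applies only to history events. This one is such an event because it
    depends on rounds up to [r] alone; the induction follows how each round extends the list. *)
Lemma history_draws (E : nat -> set X) (F : nat -> set (codebook Y)) r m :
  (forall i, measurable (E i)) -> (forall i, measurable (F i)) ->
  history A Xs Cs r.+1 [set w | size (draws r w) = m /\
    forall i, (i < m)%N -> E i (nth point (draws r w) i).1 /\
                           F i (nth point (draws r w) i).2].
Proof.
move=> mE mF; elim: r m => [|r IHr] m.
  case: m => [|m].
    rewrite (_ : [set _ | _] = setT); last by apply/seteqP; split.
    exact: (@measurableT _ (g_sigma_algebraType _)).
  rewrite (_ : [set _ | _] = set0); last by apply/seteqP; split => w // [].
  exact: (@measurable0 _ (g_sigma_algebraType _)).
have HA : history A Xs Cs r.+2 (A r.+1 @^-1` [set a]).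
  by apply: sub_sigma_algebra; left; exists r.+1, a; rewrite leqnSn.
pose S j := [set w | size (draws r w) = j /\ forall i, (i < j)%N ->
  E i (nth point (draws r w) i).1 /\ F i (nth point (draws r w) i).2].
have HS j : history A Xs Cs r.+2 (S j) by exact: history_le (IHr j).
(* Either round [r.+1] plays another arm and the list is unchanged, or it plays [a], so that [m] is
   some [j.+1] and the new draw sits at position [j]. *)
rewrite (_ : [set _ | _] = (S m `&` ~` (A r.+1 @^-1` [set a])) `|`
  (if m is j.+1 then S j `&` A r.+1 @^-1` [set a] `&`
     (Xs r.+1 @^-1` E j `&` Cs r.+1 @^-1` F j) else set0)).
  apply: (@measurableU _ (g_sigma_algebraType _)).
    apply: (@measurableI _ (g_sigma_algebraType _)); first exact: HS.
    exact: (@measurableC _ (g_sigma_algebraType _)).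
  case: m => [|m]; first exact: (@measurable0 _ (g_sigma_algebraType _)).
  apply: (@measurableI _ (g_sigma_algebraType _)).
    by apply: (@measurableI _ (g_sigma_algebraType _)); first exact: HS.
  apply: (@measurableI _ (g_sigma_algebraType _));
    apply: sub_sigma_algebra; right.
    by left; exists r.+1, (E m); rewrite ltnSn.
  by right; exists r.+1, (F m); rewrite ltnSn.
apply/seteqP; split => w /=; rewrite drawsS; case: eqP => Aa.
- rewrite size_rcons => -[<- H]; right; split; [split=> //|].
    split => // i ilt; have := H i (ltnW ilt).
    by rewrite nth_rcons ilt.
  by have := H _ (ltnSn _); rewrite nth_rcons ltnn eqxx.
- by move=> H; left.
- case=> [[_ /(_ Aa)//]|]; case: m => // m [[[sm H] _] Hm].
  rewrite size_rcons sm; split => // i; rewrite ltnS leq_eqVlt nth_rcons sm.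
  by case: (ltngtP i m) => //= [im _|-> _] //; exact: H.
- by case=> [[]//|]; case: m => // m [[_ /Aa]].
Qed.

Lemma measurable_played r :
  measurable_fun [set: Omega] (fun w => A r.+1 w == a).
Proof.
apply: (measurable_fun_bool true); rewrite setTI.
rewrite (_ : _ @^-1` _ = A r.+1 @^-1` [set a]); first exact: measurable_action.
by apply/seteqP; split => w /eqP.
Qed.

Lemma measurable_size_draws r :
  measurable_fun [set: Omega] (fun w => size (draws r w)).
Proof.
elim: r => [|r IHr]; first exact: measurable_cst.
rewrite (_ : (fun _ => _) = fun w => if A r.+1 w == a
    then (size (draws r w)).+1 else size (draws r w)); last first.
  by apply/funext => w; rewrite drawsS; case: ifP; rewrite ?size_rcons.
apply: measurable_fun_ifT => //; last exact: (@measurableT_comp _ _ _ _ _ _ S).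
exact: measurable_played.
Qed.

Section completion.
Context dW (W : measurableType dW) (PW : probability W R)
  (U : nat -> W -> X * codebook Y).

(* The arm may be played fewer than [n] times: the missing draws are read off
   the auxiliary sequence [U]. *)
Definition completed_draw r i (z : Omega * W) : X * codebook Y :=
  nth (U i z.2) (draws r z.1) i.

(** A play of the arm appends its draw at position [size (draws r z.1)], so exactly this coordinate
    switches from the auxiliary draw to the real one. *)
Lemma completed_drawS r i z : completed_draw r.+1 i z =
  if (A r.+1 z.1 == a) && (size (draws r z.1) == i)
  then (Xs r.+1 z.1, Cs r.+1 z.1) else completed_draw r i z.
Proof.
rewrite /completed_draw drawsS; case: ifP => //= _; rewrite nth_rcons.
by case: ltngtP => // H; rewrite nth_default // ltnW.
Qed.

Hypothesis measurable_aux : forall i, measurable_fun [set: W] (U i).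

Lemma measurable_completed_draw r i :
  measurable_fun [set: Omega * W] (completed_draw r i).
Proof.
elim: r => [|r IHr].
  rewrite (_ : completed_draw 0 i = U i \o snd); last first.
    by apply/funext => z; rewrite /completed_draw nth_nil.
  by apply: measurableT_comp => //; exact: measurable_snd.
rewrite (_ : completed_draw r.+1 i = fun z =>
    if (A r.+1 z.1 == a) && (size (draws r z.1) == i)
    then (Xs r.+1 z.1, Cs r.+1 z.1) else completed_draw r i z); last first.
  by apply/funext => z; exact: completed_drawS.
apply: measurable_fun_ifT => //.
- apply: (@measurableT_comp _ _ _ _ _ _
    (fun w => (A r.+1 w == a) && (size (draws r w) == i))).
    apply: measurable_and; first exact: measurable_played.
    apply: measurable_fun_eqn; [exact: measurable_size_draws|].
    exact: measurable_cst.
  exact: measurable_fst.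
- apply: (@measurableT_comp _ _ _ _ _ _ (fun w => (Xs r.+1 w, Cs r.+1 w))).
    by apply: measurable_fun_pair; exact: measurable_funP.
  exact: measurable_fst.
Qed.

Context (PX : probability X R) (PCa : probability (codebook Y) R) (n : nat).

Hypothesis fresh_draw : forall r (H : set Omega) (E : set X)
    (F : set (codebook Y)),
  history A Xs Cs r.+1 H -> measurable E -> measurable F ->
  P (H `&` A r.+1 @^-1` [set a] `&` (Xs r.+1 @^-1` E `&` Cs r.+1 @^-1` F))
  = (P (H `&` A r.+1 @^-1` [set a]) * (PX E * PCa F))%E.

Hypothesis iid_aux : forall G : nat -> set (X * codebook Y),
  (forall i, measurable (G i)) ->
  PW [set u | forall i, (i < n)%N -> G i (U i u)]
  = (\prod_(i < n) (PX \x PCa) (G i))%E.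

Lemma iid_aux_suffix (E : nat -> set X) (F : nat -> set (codebook Y)) m :
  (forall i, measurable (E i)) -> (forall i, measurable (F i)) ->
  PW [set u | forall i, (i < n)%N -> (m <= i)%N -> (E i `*` F i) (U i u)]
  = (\prod_(i < n | (m <= i)%N) (PX (E i) * PCa (F i)))%E.
Proof.
move=> mE mF.
(* Coordinates below [m] are left unconstrained, so their factors equal 1. *)
pose G i := if (m <= i)%N then E i `*` F i else setT.
have mG i : measurable (G i).
  by rewrite /G; case: ifP => // _; exact: measurableX.
rewrite big_mkcond /= (eq_bigr (fun i : 'I_n => (PX \x PCa)%E (G i))).
  rewrite -iid_aux //; congr (PW _); apply/seteqP; split => u /= H i ltin.
    by rewrite /G; case: ifP => // mi; exact: H.
  by move=> mi; have := H i ltin; rewrite /G mi.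
move=> i _; rewrite /G; case: ifP => _; first by rewrite product_probabilityE.
exact/esym/probability_setT.
Qed.

(* Passing from [r] to [r.+1] only replaces one auxiliary draw by the draw of
   round [r.+1], which has the same law and is independent of the rest. *)
Lemma completed_draws_iid (E : nat -> set X) (F : nat -> set (codebook Y)) r :
  (forall i, measurable (E i)) -> (forall i, measurable (F i)) ->
  (P \x PW)%E [set z | forall i, (i < n)%N ->
                 (E i `*` F i) (completed_draw r i z)]
  = (\prod_(i < n) (PX (E i) * PCa (F i)))%E.
Proof.
move=> mE mF.
pose V s := [set z | forall i, (i < n)%N ->
                 (E i `*` F i) (completed_draw s i z)].
have mV s : measurable (V s).
  rewrite (_ : V s = \bigcap_(i in [set i | (i < n)%N])
    (completed_draw s i @^-1` (E i `*` F i))) //.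
  apply: bigcap_measurableType => // i _; rewrite -[X in measurable X]setTI.
  by apply: measurable_completed_draw => //; exact: measurableX.
pose T m := [set u | forall i, (i < n)%N -> (m <= i)%N ->
  (E i `*` F i) (U i u)].
have mT m : measurable (T m).
  rewrite (_ : T m = \bigcap_(i in [set i | (i < n)%N /\ (m <= i)%N])
    (U i @^-1` (E i `*` F i))).
    apply: bigcap_measurableType => // i _; rewrite -[X in measurable X]setTI.
    by apply: measurable_aux => //; exact: measurableX.
  by apply/seteqP; split => u /= H i; [case; exact: H|move=> *; exact: H].
rewrite -/(V r); elim: r => [|r IHr].
  rewrite (_ : V 0%N = setT `*` T 0%N).
    rewrite product_probabilityE //.
    by rewrite probability_setT mul1e -(iid_aux_suffix 0 mE mF).
  apply/seteqP; split => -[w u]; rewrite /V /T /= /completed_draw /=.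
    by move=> H; split => // i ltin _; have := H i ltin; rewrite nth_nil.
  by move=> [_ H] i ltin; rewrite nth_nil; exact: H.
rewrite -{}IHr.
(* [f] is the coordinate below [n] that round [r.+1] replaces, with [n] standing for none. The
   events at [r] and [r.+1] are compared on each fiber of [f]. *)
pose f (z : Omega * W) := if (A r.+1 z.1 == a) && (size (draws r z.1) < n)%N
  then size (draws r z.1) else n.
have fn z : (f z < n.+1)%N.
  by rewrite /f; case: ifP => // /andP[_ /ltnW].
have mA := measurable_played r.
have mf : measurable_fun [set: Omega * W] f.
  apply: (@measurableT_comp _ _ _ _ _ _ (fun w =>
    if (A r.+1 w == a) && (size (draws r w) < n)%N
    then size (draws r w) else n)); last exact: measurable_fst.
  apply: measurable_fun_ifT => //; last exact: measurable_size_draws.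
  apply: measurable_and => //; apply: measurable_fun_ltn => //.
  exact: measurable_size_draws.
have mfj j : measurable (f @^-1` [set j]).
  by rewrite -[X in measurable X]setTI; exact: mf.
rewrite !(measure_fibers _ (mV _) fn mfj); apply: eq_bigr => -[j /=].
rewrite ltnS leq_eqVlt => jn _.
have [jltn|nlej] := ltnP j n; last first.
  (* On the fiber of [n] no coordinate below [n] changes, so the two events coincide there. *)
  congr (_ _); apply/seteqP; split => -[w u] [Vz fz]; split => // i ltin.
    have := Vz i ltin; rewrite completed_drawS; case: ifP => //.
    move=> /andP[Aa /eqP si]; move: fz; rewrite /f /= Aa si ltin /= => ij.
    by move: nlej; rewrite -ij leqNgt ltin.
  rewrite completed_drawS; case: ifP => [|_]; last exact: Vz.
  move=> /andP[Aa /eqP si]; move: fz; rewrite /f /= Aa si ltin /= => ij.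
  by move: nlej; rewrite -ij leqNgt ltin.
pose H := [set w | size (draws r w) = j /\ forall i, (i < j)%N ->
  E i (nth point (draws r w) i).1 /\ F i (nth point (draws r w) i).2].
have HH : history A Xs Cs r.+1 H by exact: history_draws.
have mH : measurable H by exact: history_measurable HH.
have mAr : measurable (A r.+1 @^-1` [set a]) by exact: measurable_action.
have fj w u : f (w, u) = j <-> A r.+1 w = a /\ size (draws r w) = j.
  rewrite /f /=; split => [|[-> ->]]; last by rewrite eqxx jltn.
  case: ifP => [/andP[/eqP-> _] -> //|_ nj].
  by move: jltn; rewrite nj ltnn.
(* On the fiber of [j] the event is a rectangle: the coordinates below [j] are real draws, those
   from [j] on are auxiliary. *)
rewrite (_ : V r `&` _ = (H `&` A r.+1 @^-1` [set a]) `*` T j); last first.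
  apply/seteqP; split => -[w u] /=.
    move=> [Vz /fj[Aa sj]]; split; first split => //.
      split => // i ij; have := Vz i (ltn_trans ij jltn).
      by rewrite /completed_draw /= (set_nth_default point) // sj.
    move=> i ltin ji; have := Vz i ltin.
    by rewrite /completed_draw /= nth_default // sj.
  move=> [[[sj Hw] Aa] Tu]; split; last exact/fj.
  move=> i ltin; rewrite /completed_draw /=; have [ij|ji] := ltnP i j.
    by rewrite (set_nth_default point) ?sj //; exact: Hw.
  by rewrite nth_default ?sj //; exact: Tu.
(* After round [r.+1], coordinate [j] is the fresh draw and the auxiliary ones start at [j.+1]. *)
rewrite (_ : V r.+1 `&` _ = (H `&` A r.+1 @^-1` [set a] `&`
  (Xs r.+1 @^-1` E j `&` Cs r.+1 @^-1` F j)) `*` T j.+1); last first.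
  apply/seteqP; split => -[w u] /=.
    move=> [Vz /fj[Aa sj]]; split; first split => //; first split => //.
    - split => // i ij; have := Vz i (ltn_trans ij jltn).
      rewrite completed_drawS /= Aa sj eqxx gtn_eqF //=.
      by rewrite /completed_draw /= (set_nth_default point) // sj.
    - by have := Vz j jltn; rewrite completed_drawS /= Aa sj !eqxx.
    - move=> i ltin ji; have := Vz i ltin.
      rewrite completed_drawS /= Aa sj eqxx ltn_eqF //=.
      by rewrite /completed_draw /= nth_default // sj ltnW.
  move=> [[[[sj Hw] Aa] EFj] Tu]; split; last exact/fj.
  move=> i ltin; rewrite completed_drawS /= Aa sj eqxx /=.
  rewrite /completed_draw /=; have [ij|ji|->] := ltngtP i j => //.
    by rewrite (set_nth_default point) ?sj //; exact: Hw.
  by rewrite nth_default ?sj ?(ltnW ji) //; exact: Tu.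
rewrite !product_probabilityE //; [|exact: measurableI|]; last first.
  by apply: measurableI; [exact: measurableI|];
    apply: measurableI; exact: measurable_funPTI.
(* Freshness yields the factor [PX (E j) * PCa (F j)], which is the factor of index [j] in the
   auxiliary product from [j] on. *)
rewrite fresh_draw // !iid_aux_suffix // -muleA; congr (_ * _)%E.
rewrite [in RHS](bigD1 (Ordinal jltn)) //=; congr (_ * _)%E.
by apply: eq_bigl => i; rewrite -val_eqE /= ltn_neqAle eq_sym andbC.
Qed.

End completion.

End adaptive_sampling.

(** * Failure of a confidence interval at a prescribed number of plays *)

Definition deviation (R : realType) dO dX dY (Omega : measurableType dO)
  (X : measurableType dX) (Y : measurableType dY) (k : nat)
  (P : probability Omega R) (rho : X * Y -> R) (d : R)
  (A : nat -> Omega -> 'I_k) (Xs : nat -> {RV P >-> X})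
  (Cs : nat -> {RV P >-> codebook Y}) (c eta delta m : R) (a : 'I_k)
  (r n : nat) : set Omega :=
  [set w | size (draws A Xs Cs a r w) = n /\
    ~ (`| n%:R^-1%:E * (\sum_(z <- draws A Xs Cs a r w) cost rho d z.1 z.2)
          - m%:E | <= (radius c eta delta n)%:E)%E].

(** The concentration hypothesis is applied to the completed draws on the product space. Fixing the
    number of plays at [n] makes them agree with the actual draws on the event in question. *)
Lemma deviation_prob (R : realType) dO dX dY (Omega : measurableType dO)
  (X : measurableType dX) (Y : measurableType dY) (k : nat)
  (P : probability Omega R) (A : nat -> Omega -> 'I_k)
  (Xs : nat -> {RV P >-> X}) (Cs : nat -> {RV P >-> codebook Y}) (a : 'I_k)
  (rho : X * Y -> R) (d : R) (PX : probability X R) (Q : probability Y R)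
  (PCa : probability (codebook Y) R) (c eta delta : R) (n r : nat) :
  measurable_fun [set: X * Y] rho ->
  (forall t b, (1 <= t)%N -> measurable (A t @^-1` [set b])) ->
  (forall s (H : set Omega) (E : set X) (F : set (codebook Y)),
    history A Xs Cs s.+1 H -> measurable E -> measurable F ->
    P (H `&` A s.+1 @^-1` [set a] `&` (Xs s.+1 @^-1` E `&` Cs s.+1 @^-1` F))
    = (P (H `&` A s.+1 @^-1` [set a]) * (PX E * PCa F))%E) ->
  concentration_constant c -> 0 < eta ->
  (forall x, (eta%:E < match_prob rho d Q x)%E) -> is_codebook_law Q PCa ->
  (1 <= n)%N -> 0 < delta -> delta < 2^-1 ->
  measurable (deviation rho d A Xs Cs c eta delta (mean_cost rho d PX PCa)
    a r n) /\
  (P (deviation rho d A Xs Cs c eta delta (mean_cost rho d PX PCa) a r n)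
   <= delta%:E)%E.
Proof.
move=> mrho mA fresh [c0 hc] eta0 hmatch hPC n1 delta0 delta2.
set dev := deviation _ _ _ _ _ _ _ _ _ _ _ _.
have [dW [W [PW [U [mU UE]]]]] := iid_sequence_exists (PX \x PCa)%E n.
pose Z := completed_draw A Xs Cs a U r.
have mZ i : measurable_fun [set: Omega * W] (Z i).
  exact: measurable_completed_draw.
have mZ1 i : measurable_fun [set: Omega * W] (fun z => (Z i z).1).
  by apply: measurableT_comp (mZ i); exact: measurable_fst.
have mZ2 i : measurable_fun [set: Omega * W] (fun z => (Z i z).2).
  by apply: measurableT_comp (mZ i); exact: measurable_snd.
pose ZX (i : 'I_n) : {RV (P \x PW)%E >-> X} := mfun_Sub (mem_set (mZ1 i)).
pose ZC (i : 'I_n) : {RV (P \x PW)%E >-> codebook Y} :=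
  mfun_Sub (mem_set (mZ2 i)).
pose avg (z : Omega * W) : \bar R := (n%:R^-1%:E *
  (\sum_(i < n) cost rho d (Z i z).1 (Z i z).2))%E.
pose good := [set z | (`| avg z - (mean_cost rho d PX PCa)%:E |
  <= (radius c eta delta n)%:E)%E].
have mgood : measurable good.
  rewrite -[good]setTI; apply: emeasurable_fun_infty_c => //.
  apply: measurableT_comp; first exact: abse_measurable.
  apply: emeasurable_funB; last exact: measurable_cst.
  apply: measurable_funeM; apply: emeasurable_sum => i.
  exact: (measurableT_comp (measurable_cost d mrho) (mZ i)).
have iid : iid_samples PX PCa ZX ZC.
  move=> E F mE mF.
  (* Families indexed by ['I_n] are extended to [nat] by [setT], to match the indexing of
     [completed_draws_iid]. *)
  pose ext T (G : 'I_n -> set T) j :=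
    if insub j is Some i then G i else setT.
  have extE T (G : 'I_n -> set T) (i : 'I_n) : ext T G i = G i.
    by rewrite /ext valK.
  have mE' j : measurable (ext X E j) by rewrite /ext; case: insub.
  have mF' j : measurable (ext (codebook Y) F j) by rewrite /ext; case: insub.
  rewrite -big_split /=.
  under [RHS]eq_bigr => i _ do rewrite -(extE X E i) -(extE (codebook Y) F i).
  rewrite -(completed_draws_iid mA mU fresh UE r mE' mF').
  congr (_ _); apply/seteqP; split => z /= H i.
    by move=> ltin; have := H (Ordinal ltin); rewrite -!extE.
  by rewrite -!extE; exact: H.
have := hc _ _ X Y rho d PX eta Q PCa mrho eta0 hmatch hPC n delta n1
  delta0 delta2 _ _ (P \x PW)%E ZX ZC iid.
rewrite -/good => Pgood.
have sumE w u : size (draws A Xs Cs a r w) = n ->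
  (\sum_(i < n) cost rho d (Z i (w, u)).1 (Z i (w, u)).2 =
   \sum_(z <- draws A Xs Cs a r w) cost rho d z.1 z.2)%E.
  move=> sn; rewrite (big_nth point) sn big_mkord; apply: eq_bigr => i _.
  by rewrite /Z /completed_draw /= (set_nth_default point) // sn.
(* When the arm has exactly [n] draws, [avg] does not depend on the auxiliary variable. Freezing
   that variable at [point] exhibits the event through a section of a measurable set. *)
have devE : dev = [set w | size (draws A Xs Cs a r w) = n] `&`
    ysection (~` good) point.
  apply/seteqP; split => w /= [sn];
    rewrite /dev /deviation /ysection /= in_setE /good /avg /= sumE //.
have mdev : measurable dev.
  rewrite devE; apply: measurableI; last first.
    by apply: measurable_ysection; exact: measurableC.
  rewrite -[X in measurable X]setTI.
  have := measurable_size_draws Xs Cs a mA r measurableT.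
  by move=> /(_ [set n] I).
split => //.
(* The probability is computed on the product space, where the cylinder over [dev] lies in the
   complement of [good]. *)
have -> : P dev = (P \x PW)%E (dev `*` setT).
  by rewrite product_probabilityE // probability_setT mule1.
apply: (@le_trans _ _ ((P \x PW)%E (~` good))).
  apply: le_measure; rewrite ?inE.
  - exact: measurableX.
  - exact: measurableC.
  - by move=> -[w u] /= [[sn H] _]; rewrite /good /avg /= sumE.
rewrite probability_setC // leeBlDr ?fin_num_measure //.
by move: Pgood; rewrite EFinB leeBlDr // addeC.
Qed.

(** * Real estimates: confidence radii and the series of failure probabilities *)

Lemma abse_dist_le (R : realDomainType) (x : \bar R) (b r : R) :
  (`|x - b%:E| <= r%:E)%E -> ((b - r)%:E <= x)%E /\ (x <= (b + r)%:E)%E.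
Proof.
case: x => [x| |] //=.
by rewrite !lee_fin ler_norml => /andP[h1 h2]; split; lra.
Qed.

Lemma radius_powR (R : realType) (c eta alpha x : R) (n : nat) :
  radius c eta (x `^ (- alpha)) n =
  c / eta * Num.sqrt (n%:R^-1 * (alpha * ln x)).
Proof. by rewrite /radius powRN invrK ln_powR. Qed.

(** Squaring turns the claim into a lower bound on [n]. The radius belongs to round [x], whereas the
    threshold uses a horizon [y >= x], so that one threshold serves all rounds up to [y]. *)
Lemma radius_lt_half_gap (R : realType) (c eta alpha Delta x y : R) (n : nat) :
  0 < c -> 0 < eta -> 0 < alpha -> 0 < Delta -> 1 <= x -> x <= y ->
  4 * c ^+ 2 * alpha / (eta ^+ 2 * Delta ^+ 2) * ln y < n%:R ->
  2 * radius c eta (x `^ (- alpha)) n < Delta.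
Proof.
move=> c0 eta0 alpha0 Delta0 x1 xy un; rewrite radius_powR.
have lnx0 : 0 <= ln x by exact: ln_ge0.
have lnxy : ln x <= ln y.
  by rewrite ler_ln // posrE; [exact: lt_le_trans x1|
    exact: lt_le_trans (le_trans x1 xy)].
have n0 : 0 < n%:R :> R.
  apply: le_lt_trans un; apply: mulr_ge0; last exact: le_trans lnxy.
  by rewrite divr_ge0 ?mulr_ge0 ?sqr_ge0 // ltW.
have ce0 : 0 <= c / eta by rewrite divr_ge0 // ltW.
rewrite -(@ltr_pXn2r _ 2) // ?nnegrE; last exact: ltW.
  2: by do 2 ?[apply: mulr_ge0 => //]; rewrite sqrtr_ge0.
rewrite !exprMn sqr_sqrtr; last first.
  by rewrite mulr_ge0 ?invr_ge0 ?ler0n // mulr_ge0 // ltW.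
have D2 : 0 < Delta ^+ 2 by rewrite exprn_gt0.
have e2 : 0 < eta ^+ 2 by rewrite exprn_gt0.
apply: (@le_lt_trans _ _ (4 * c ^+ 2 * alpha / eta ^+ 2 * ln y / n%:R)).
  rewrite [leLHS](_ : _ = 4 * c ^+ 2 * alpha / eta ^+ 2 * ln x / n%:R).
    apply: ler_wpM2r; first by rewrite invr_ge0 ltW.
    apply: ler_wpM2l => //.
    by rewrite divr_ge0 ?mulr_ge0 ?sqr_ge0 // ltW.
  by field; rewrite (lt0r_neq0 n0) (lt0r_neq0 eta0).
rewrite ltr_pdivrMr // -ltr_pdivrMl //.
apply: le_lt_trans un; rewrite le_eqVlt; apply/orP; left; apply/eqP.
by field; rewrite (lt0r_neq0 Delta0) (lt0r_neq0 eta0).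
Qed.

(** A mean value inequality for x^(-beta), obtained from ln(x+1) - ln x >= 1/(x+1) and from exp v >=
    1 + v. *)
Lemma powR_telescope (R : realType) (beta x : R) : 0 <= beta -> 0 < x ->
  beta * (x + 1) `^ (- beta) / (x + 1) <= x `^ (- beta) - (x + 1) `^ (- beta).
Proof.
move=> b0 x0; have y0 : 0 < x + 1 by lra.
have [xn0 yn0] := (lt0r_neq0 x0, lt0r_neq0 y0).
rewrite /powR (negbTE xn0) (negbTE yn0).
have -> : - beta * ln x = - beta * ln (x + 1) + beta * (ln (x + 1) - ln x).
  by ring.
rewrite expRD; set E := expR (- beta * ln (x + 1)).
have E0 : 0 < E by exact: expR_gt0.
have l : (x + 1)^-1 <= ln (x + 1) - ln x.
  (* The bound ln(1+z) <= z at z = -1/(x+1), where 1+z = x/(x+1). *)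
  have := @le_ln1Dx R (- (x + 1)^-1).
  have -> : 1 + - (x + 1)^-1 = x / (x + 1) by field.
  rewrite ln_div ?posrE //.
  have y1 : (x + 1)^-1 < 1 by rewrite invf_lt1 //; lra.
  by move=> H; have := H _; lra.
have e := expR_ge1Dx (beta * (ln (x + 1) - ln x)).
have bl : beta * (x + 1)^-1 <= beta * (ln (x + 1) - ln x) by exact: ler_wpM2l.
have : E * (1 + beta * (x + 1)^-1) <= E * expR (beta * (ln (x + 1) - ln x)).
  by rewrite ler_pM2l //; lra.
lra.
Qed.

(** With beta = alpha - 2, the term r (r+1)^(-alpha) is at most (r+1)^(-beta) / (r+1), which
    [powR_telescope] bounds by a telescoping difference divided by beta. *)
Lemma sum_failure_prob (R : realType) (alpha : R) (t : nat) : 2 < alpha ->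
  \sum_(r < t) r%:R * r.+1%:R `^ (- alpha) <= (alpha - 2)^-1.
Proof.
move=> alpha2; have b0 : 0 < alpha - 2 by lra.
(* The telescoped value is what the induction carries. It starts at [t = 1], where the only term
   vanishes, because [powR_telescope] needs a positive base. *)
have H : (1 <= t)%N -> \sum_(r < t) r%:R * r.+1%:R `^ (- alpha) <=
    (1 - t%:R `^ (- (alpha - 2))) / (alpha - 2).
  elim: t => [//|t IHt _]; rewrite big_ord_recr /=.
  have [->|t0] := posnP t.
    by rewrite big_ord0 mul0r add0r powR1 subrr mul0r.
  have tR0 : 0 < t%:R :> R by rewrite ltr0n.
  have y0 : 0 < t%:R + 1 :> R by lra.
  have := IHt t0; have := powR_telescope (ltW b0) tR0.
  rewrite -[t.+1]addn1 natrD.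
  set y := t%:R + 1 in y0 *; set s := \sum_(r < t) _.
  have -> : y `^ (- alpha) = y `^ (- (alpha - 2)) / y ^+ 2.
    rewrite -powR_mulrn ?ltW // -powRB; last by rewrite (lt0r_neq0 y0) implybT.
    by congr (_ `^ _); ring.
  set p := y `^ _; set q := t%:R `^ _ => h1 h2.
  have p0 : 0 <= p by exact: powR_ge0.
  have : t%:R * (p / y ^+ 2) <= p / y.
    rewrite mulrA ler_pdivrMr ?exprn_gt0 // expr2 mulrA divfK ?lt0r_neq0 //.
    by rewrite mulrC ler_wpM2l // /y lerDl.
  have h3 : p / y <= (q - p) / (alpha - 2).
    by rewrite ler_pdivlMr // mulrC mulrA.
  have : (1 - q) / (alpha - 2) + (q - p) / (alpha - 2) =
         (1 - p) / (alpha - 2) by rewrite -mulrDl; congr (_ / _); ring.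
  lra.
have [->|t0] := posnP t; first by rewrite big_ord0 invr_ge0 ltW.
apply: le_trans (H t0) _; rewrite -[leRHS]mul1r; apply: ler_wpM2r.
  by rewrite invr_ge0 ltW.
by rewrite lerBlDr lerDl powR_ge0.
Qed.

Lemma powRN_lt_half (R : realType) (alpha x : R) : 2 < alpha -> 2 <= x ->
  x `^ (- alpha) < 2^-1.
Proof.
move=> alpha2 x2; rewrite powRN ltf_pV2 ?posrE ?powR_gt0 //; last by lra.
apply: (@lt_le_trans _ _ (x `^ 2%:R)); last first.
  by apply: ler_powR; lra.
rewrite powR_mulrn; last by lra.
nra.
Qed.

(** * Pathwise consequences of the selection rule *)

Section lcb_argument.
Context (R : realType) dO dX dY (Omega : measurableType dO)
  (X : measurableType dX) (Y : measurableType dY) (k : nat)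
  (P : probability Omega R) (rho : X * Y -> R) (d : R)
  (A : nat -> Omega -> 'I_k) (Xs : nat -> {RV P >-> X})
  (Cs : nat -> {RV P >-> codebook Y}).

Lemma past_costsE r a w : past_costs rho d A Xs Cs r.+1 a w =
  [seq cost rho d z.1 z.2 | z <- draws A Xs Cs a r w].
Proof. by rewrite /past_costs /draws -map_comp. Qed.

Lemma lcb_past_costsE c eta delta r a w :
  (0 < size (draws A Xs Cs a r w))%N ->
  lcb c eta (past_costs rho d A Xs Cs r.+1 a w) delta =
  ((size (draws A Xs Cs a r w))%:R^-1%:E *
     (\sum_(z <- draws A Xs Cs a r w) cost rho d z.1 z.2)
   - (radius c eta delta (size (draws A Xs Cs a r w)))%:E)%E.
Proof. by rewrite /lcb past_costsE size_map big_map; case: size. Qed.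

(** If both intervals were correct, the index of [a] would be at least [m a] minus twice its radius,
    hence above [m astar], which is at least the index of [astar]; then [a] would not have been
    chosen. *)
Lemma lcb_suboptimal_deviation c eta delta (m : 'I_k -> R) astar r w :
  let a := A r.+1 w in
  let n b := size (draws A Xs Cs b r w) in
  (lcb c eta (past_costs rho d A Xs Cs r.+1 a w) delta <=
   lcb c eta (past_costs rho d A Xs Cs r.+1 astar w) delta)%E ->
  (0 < n a)%N -> 2 * radius c eta delta (n a) < m a - m astar ->
  deviation rho d A Xs Cs c eta delta (m a) a r (n a) w \/
  (0 < n astar)%N /\
    deviation rho d A Xs Cs c eta delta (m astar) astar r (n astar) w.
Proof.
move=> a n le_lcb na gap_a; apply: contrapT => /not_orP[+ Nstar].
move=> /not_andP[//|/contrapT/abse_dist_le[lo _]].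
move: le_lcb; rewrite lcb_past_costsE // -/(n a) => le_lcb.
(* An optimal arm not yet played has index [-oo], which is below the index of [a], so the choice of
   [a] is already contradictory. *)
have [nstar|nstar] := posnP (n astar).
  move: le_lcb lo; rewrite /lcb past_costsE size_map -/(n astar) nstar.
  by case: (_ * _)%E.
move/not_andP : Nstar => [//|/not_andP[//|/contrapT/abse_dist_le[_ hi]]].
move: le_lcb; rewrite lcb_past_costsE // -/(n astar).
move: lo hi; case: (_ * _)%E => [x| |] //; case: (_ * _)%E => [y| |] //.
by rewrite -!EFinB !lee_fin => *; lra.
Qed.

(** The first [N.+1] plays are granted; every further play happens when the arm already has more
    than [N] draws and is therefore counted by the sum. *)
Lemma size_draws_le_count N a t w :
  (size (draws A Xs Cs a t w) <= N.+1 +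
    \sum_(r < t) ((A r.+1 w == a) && (N < size (draws A Xs Cs a r w))))%N.
Proof.
elim: t => [//|t IHt]; rewrite drawsS big_ord_recr /= addnA.
case: eqP => _ /=; last by rewrite addn0.
rewrite size_rcons; case: (ltnP N) => h /=; first by rewrite addn1.
by rewrite addn0 (leq_trans _ (leq_addr _ _)).
Qed.

Lemma sum_gap_draws (Delta : 'I_k -> R) t w :
  \sum_(1 <= i < t.+1) Delta (A i w) =
  \sum_(a < k) Delta a * (size (draws A Xs Cs a t w))%:R.
Proof.
elim: t => [|t IHt].
  by rewrite big_geq // big1 // => a _; rewrite mulr0.
rewrite big_nat_recr //= IHt (bigD1 (A t.+1 w)) //= [RHS](bigD1 (A t.+1 w)) //=.
rewrite drawsS eqxx size_rcons -[_.+1%:R]natr1 mulrDr mulr1.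
rewrite addrAC; congr (_ + _); apply: eq_bigr => a /negbTE.
by rewrite drawsS eq_sym => ->.
Qed.

End lcb_argument.

(** * Probability of late plays and the resulting regret *)

Section regret.
Context (R : realType) dO dX dY (Omega : measurableType dO)
  (X : measurableType dX) (Y : measurableType dY) (k : nat)
  (P : probability Omega R) (rho : X * Y -> R) (d : R)
  (PX : probability X R) (Q : 'I_k -> probability Y R)
  (PC : 'I_k -> probability (codebook Y) R) (c eta alpha : R) (astar : 'I_k)
  (A : nat -> Omega -> 'I_k) (Xs : nat -> {RV P >-> X})
  (Cs : nat -> {RV P >-> codebook Y}).

Definition late_play (N : nat) (a : 'I_k) (r : nat) : set Omega :=
  [set w | A r.+1 w = a /\ (N < size (draws A Xs Cs a r w))%N].

Hypotheses (hrho : measurable_fun [set: X * Y] rho)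
  (hPC : forall a, is_codebook_law (Q a) (PC a))
  (hc : concentration_constant c) (heta : 0 < eta)
  (hmatch : forall x a, (eta%:E < match_prob rho d (Q a) x)%E)
  (halpha : 2 < alpha)
  (hrun : lcb_run rho d A Xs Cs PX PC c eta (fun t => t%:R `^ (- alpha))).

Let b a := mean_cost rho d PX (PC a).

Lemma measurable_late_play N a r : measurable (late_play N a r).
Proof.
have mA := lcb_measurable hrun.
apply: measurableI; first exact: mA.
have := measurable_size_draws Xs Cs a mA r measurableT.
by move=> /(_ [set n | (N < n)%N] I); rewrite setTI.
Qed.

(** A late play forces a deviation of [a] or of [astar] at a number of plays between 1 and [r].
    These are [2 * r] events, each of probability at most the confidence parameter of round
    [r.+1]. *)
Lemma late_play_prob a r (y : R) : 0 < gap b astar a -> r.+1%:R <= y ->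
  (P (late_play (Num.truncn
       (4 * c ^+ 2 * alpha / (eta ^+ 2 * gap b astar a ^+ 2) * ln y)) a r)
   <= (2 * (r%:R * r.+1%:R `^ (- alpha)))%:E)%E.
Proof.
move=> gap_a ry; set u := _ * ln y; set N := Num.truncn u.
set delta := r.+1%:R `^ (- alpha).
have c0 : 0 < c by case: hc.
have alpha0 : 0 < alpha by exact: lt_trans halpha.
have mA := lcb_measurable hrun.
pose dev e n := deviation rho d A Xs Cs c eta delta (b e) e r n.
have devP e n : (n < r)%N -> measurable (dev e n.+1) /\
    (P (dev e n.+1) <= delta%:E)%E.
  move=> nr.
  apply: (@deviation_prob R _ _ _ Omega X Y k P A Xs Cs e rho d PX (Q e)
    (PC e) c eta delta n.+1 r hrho mA _ hc heta (hmatch^~ e) (hPC e)) => //.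
  - by move=> s H E F; exact: (lcb_fresh hrun).
  - exact: powR_gt0.
  (* The existence of some [n < r] makes the current round [r.+1] at least 2, which brings its
     confidence parameter below 1/2. *)
  - by apply: powRN_lt_half => //; rewrite ler_nat ltnS (leq_ltn_trans _ nr).
have devm e n : (n < r)%N -> measurable (dev e n.+1).
  by move=> nr; case: (devP e n nr).
pose V e := \big[setU/set0]_(n < r) dev e n.+1.
have sub : late_play N a r `<=`
    V a `|` V astar.
  move=> w [Aa ltN].
  have size_pos : (0 < size (draws A Xs Cs a r w))%N.
    exact: leq_ltn_trans ltN.
  (* More than [N] plays means at least [N.+1], which exceeds [u] by the definition of
     truncation. *)
  have u_lt : u < (size (draws A Xs Cs a r w))%:R.
    by apply: lt_le_trans (truncnS_gt u) _; rewrite ler_nat.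
  have small :
      2 * radius c eta delta (size (draws A Xs Cs a r w)) < b a - b astar.
    apply: (@radius_lt_half_gap R c eta alpha (gap b astar a) _ y) => //.
    by rewrite ler1n.
  have in_union e n : (0 < n)%N -> dev e n w ->
      n = size (draws A Xs Cs e r w) -> V e w.
    case: n => // n _ dw ne; rewrite /V -(bigcup_mkord _ (fun n => dev e n.+1)).
    by exists n => //=; rewrite ne; exact: size_draws_le.
  have := @lcb_suboptimal_deviation R _ _ _ Omega X Y k P rho d A Xs Cs c
    eta delta b astar r w.
  rewrite Aa => /(_ _ size_pos small)[|dw|[pos dw]].
  - by rewrite -{1}Aa; exact: (lcb_choice hrun).
  - by left; apply: (in_union _ _ size_pos dw).
  - by right; apply: (in_union _ _ pos dw).
have bound e : (P (V e) <= (r%:R * delta)%:E)%E.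
  apply: (@le_trans _ _ (\sum_(n < r) P (dev e n.+1))%E).
    apply: (@Boole_inequality _ _ _ P (fun n => dev e n.+1)) => n.
    exact: devm.
  apply: (@le_trans _ _ (\sum_(n < r) delta%:E)%E).
    by apply: lee_sum => n _; case: (devP e n (ltn_ord n)).
  by rewrite sumEFin sumr_const card_ord mulr_natl.
have mU e : measurable (V e).
  rewrite /V -(bigcup_mkord _ (fun n => dev e n.+1)).
  by apply: bigcup_measurable => n /devm.
apply: (@le_trans _ _ (P (V a `|` V astar))).
  apply: le_measure sub; rewrite inE; first exact: measurable_late_play.
  exact: measurableU.
apply: (@le_trans _ _ (P (V a) + P (V astar))%E); first exact: measureU2.
by rewrite mulr2n mulrDl mul1r EFinD; exact: leeD.
Qed.

Hypothesis hastar : forall a, b astar <= b a.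

Let Delta := gap b astar.

(** The regret is regrouped by arm, the number of plays is bounded pathwise by
    [size_draws_le_count], and the integral is taken termwise, turning indicators of late plays into
    probabilities. *)
Lemma pseudo_regret_le (N : 'I_k -> nat) t :
  (pseudo_regret P b astar A t <=
   \sum_(a < k | (0 < Delta a)%R) (Delta a)%:E *
     ((N a).+1%:R%:E + \sum_(r < t) P (late_play (N a) a r)))%E.
Proof.
have Delta_ge0 a : 0 <= Delta a by rewrite subr_ge0.
have mA := lcb_measurable hrun.
rewrite /pseudo_regret unlock -/Delta.
pose g a r w : \bar R := (\1_(late_play (N a) a r) w)%:E.
have mg a r : measurable_fun [set: Omega] (g a r).
  exact/measurable_EFinP/measurable_indic/measurable_late_play.
have g0 a r w : (0 <= g a r w)%E by rewrite lee_fin.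
have mS a : measurable_fun [set: Omega]
    (fun w => (N a).+1%:R%:E + \sum_(r < t) g a r w)%E.
  by apply: emeasurable_funD; [exact: measurable_cst|exact: emeasurable_sum].
have S0 a w : (0 <= (N a).+1%:R%:E + \sum_(r < t) g a r w)%E.
  by apply: adde_ge0; [rewrite lee_fin|exact: sume_ge0].
rewrite (_ : (\sum_(a < k | _) _)%E = (\int[P]_w \sum_(a < k | (0 < Delta a)%R)
    ((Delta a)%:E * ((N a).+1%:R%:E + \sum_(r < t) g a r w)))%E).
  apply: ge0_le_integral => //.
  - by move=> w _; rewrite lee_fin sumr_ge0.
  - apply/measurable_EFinP.
    rewrite (_ : (fun _ => _) = fun w =>
        \sum_(a < k) Delta a * (size (draws A Xs Cs a t w))%:R).
      apply: measurable_sum => a; apply: measurable_funM => //.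
      apply: (@measurableT_comp _ _ _ _ _ _ (fun n => n%:R : R)) => //.
      exact: measurable_size_draws.
    by apply/funext => w; exact: sum_gap_draws.
  - rewrite (_ : (fun _ => _) = fun w =>
      \sum_(a <- [seq a <- index_enum 'I_k | (0 < Delta a)%R])
      ((Delta a)%:E * ((N a).+1%:R%:E + \sum_(r < t) g a r w)))%E.
      by apply: emeasurable_sum => a; exact: measurable_funeM.
    by apply/funext => w; rewrite big_filter.
  move=> w _; rewrite (sum_gap_draws A Xs Cs) -sumEFin big_mkcond /=.
  rewrite [leRHS]big_mkcond /=; apply: lee_sum => a _.
  (* Gaps are nonnegative by optimality of [astar], so an arm outside the sum has gap zero and
     contributes nothing. *)
  case: ifPn => [Da|]; last first.
    by rewrite lt_neqAle Delta_ge0 andbT negbK => /eqP <-; rewrite mul0r.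
  rewrite EFinM; apply: lee_pmul => //; first by rewrite lee_fin.
  rewrite /g sumEFin -EFinD lee_fin.
  have := size_draws_le_count A Xs Cs (N a) a t w.
  rewrite -(ler_nat R) natrD natr_sum => /le_trans; apply.
  rewrite lerD2l; apply: ler_sum => r _; rewrite indicE ler_nat.
  case: (boolP (_ && _)) => // /andP[/eqP Aa lN].
  by rewrite mem_set.
transitivity (\sum_(a < k | (0 < Delta a)%R) \int[P]_w
    ((Delta a)%:E * ((N a).+1%:R%:E + \sum_(r < t) g a r w)))%E.
  apply: eq_bigr => a _; rewrite ge0_integralZl_EFin //; congr (_ * _)%E.
  rewrite ge0_integralD //; [|by move=> w _; exact: sume_ge0|
    exact: emeasurable_sum].
  rewrite integral_cst // [X in (_ * X + _)%E](_ : _ = 1%E); last first.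
    exact: probability_setT.
  rewrite mule1; congr (_ + _)%E.
  rewrite ge0_integral_sum //; apply: eq_bigr => r _.
  by rewrite integral_indic ?setIT //; exact: measurable_late_play.
rewrite -big_filter -ge0_integral_sum //.
- by apply: eq_integral => w _; rewrite big_filter.
- by move=> a; exact: measurable_funeM.
- by move=> a w _; rewrite mule_ge0 // lee_fin.
Qed.

End regret.

(** * Choice of the thresholds and summation over the arms *)

Theorem theorem2 (R : realType) (dX dY dO : measure_display)
  (X : measurableType dX) (Y : measurableType dY) (Omega : measurableType dO)
  (rho : X * Y -> R) (d : R) (PX : probability X R)
  (k : nat) (Q : 'I_k -> probability Y R)
  (PC : 'I_k -> probability (codebook Y) R)
  (c eta alpha : R) (astar : 'I_k)
  (P : probability Omega R) (A : nat -> Omega -> 'I_k)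
  (Xs : nat -> {RV P >-> X}) (Cs : nat -> {RV P >-> codebook Y})
  (hrho : measurable_fun [set: X * Y] rho)
  (hPC : forall a, is_codebook_law (Q a) (PC a))
  (hc : concentration_constant c)
  (heta : 0 < eta)
  (hmatch : forall x a, (eta%:E < match_prob rho d (Q a) x)%E)
  (hastar : forall a, mean_cost rho d PX (PC astar) <= mean_cost rho d PX (PC a))
  (halpha : 2 < alpha)
  (hrun : lcb_run rho d A Xs Cs PX PC c eta (fun t => t%:R `^ (- alpha)))
  (t : nat) (ht : (1 <= t)%N) :
  let b := fun a => mean_cost rho d PX (PC a) in
  let Delta := gap b astar in
  (pseudo_regret P b astar A t <=
   (\sum_(a < k | 0 < Delta a)
      (4 * c ^+ 2 * alpha / (eta ^+ 2 * Delta a) * ln t%:R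
       + 2 * (alpha - 1) / (alpha - 2) * Delta a))%:E)%E.
Proof.
cbv zeta; set b := fun a => mean_cost rho d PX (PC a); set Delta := gap b astar.
have alpha0 : 0 < alpha by exact: lt_trans halpha.
have t1 : 1 <= t%:R :> R by rewrite ler1n.
(* Beyond [u a] plays, twice the radius is smaller than the gap in every round up to [t]; multiplied
   by the gap, [u a] is the logarithmic term of the bound. *)
pose u a := 4 * c ^+ 2 * alpha / (eta ^+ 2 * Delta a ^+ 2) * ln t%:R.
have := pseudo_regret_le hrun hastar (fun a => Num.truncn (u a)) t.
move=> /le_trans; apply; rewrite -sumEFin; apply: lee_sum => a Da.
have c0 : 0 < c by case: hc.
have u0 : 0 <= u a.
  rewrite mulr_ge0 ?ln_ge0 // divr_ge0 // ?mulr_ge0 ?sqr_ge0 // ltW //.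
have sumP : (\sum_(r < t) P (late_play A Xs Cs (Num.truncn (u a)) a r) <=
    (2 * (alpha - 2)^-1)%:E)%E.
  apply: (@le_trans _ _ (\sum_(r < t)
      (2 * (r%:R * r.+1%:R `^ (- alpha)))%:E)%E).
    apply: lee_sum => r _.
    apply: (late_play_prob hrho hPC hc heta hmatch halpha hrun Da).
    by rewrite ler_nat.
  by rewrite sumEFin lee_fin -mulr_sumr ler_pM2l // sum_failure_prob.
have Nu : (Num.truncn (u a)).+1%:R <= u a + 1.
  by rewrite -natr1 lerD2r; have /andP[] := truncn_itv u0.
apply: (@le_trans _ _ ((Delta a)%:E * (u a + 1 + 2 * (alpha - 2)^-1)%:E)%E).
  rewrite lee_pmul2l ?fin_numE // EFinD; apply: leeD => //; by rewrite lee_fin.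
rewrite -EFinM lee_fin.
have a2 : 0 < alpha - 2 by rewrite subr_gt0.
have -> : 4 * c ^+ 2 * alpha / (eta ^+ 2 * Delta a) * ln t%:R = Delta a * u a.
  by rewrite /u; field; rewrite (lt0r_neq0 Da) (lt0r_neq0 heta).
(* The constant equals 2 + 2/(alpha - 2), while the estimate gives 1 + 2/(alpha - 2): the 1 comes
   from rounding [u a] up, the rest from the late plays. *)
have -> : 2 * (alpha - 1) / (alpha - 2) * Delta a =
    Delta a * (2 + 2 * (alpha - 2)^-1) by field; rewrite lt0r_neq0.
by rewrite -mulrDr ler_pM2l //; lra.
Qed.
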